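(* Let $G=(V,E)$ be a graph. Then $G$ admits a pairing dominating set whose pairs are adjacent vertices if and only if $G$ has a $\{K^+_{2,\ell} : \ell\geq 0\}$-factor.
   Context: All graphs are finite and simple; $N[v]$ denotes the closed neighborhood of $v$. A pairing dominating set of a graph $G=(V,E)$ is a set of pairs of vertices $\{(u_1,v_1),\dots,(u_k,v_k)\}$ of $V$ such that all the vertices appearing in the pairs are distinct and $V=\bigcup_{i=1}^k \left(N[u_i]\cap N[v_i]\right)$. Its pairs are adjacent if $u_iv_i\in E$ for every $i$. For $\ell\ge 1$, $K^+_{2,\ell}$ is the complete bipartite graph $K_{2,\ell}$ with an additional edge between the two vertices of the part of size $2$; $K^+_{2,0}$ denotes $K_2$. For a family $\mathcal{F}$ of graphs, an $\mathcal{F}$-factor of $G$ is a spanning subgraph $H$ of $G$ (same vertex set) such that each connected component of $H$ is isomorphic to some graph in $\mathcal{F}$. *)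

(* Defs.v *)
From mathcomp Require Import all_boot.
Set Implicit Arguments.
Unset Strict Implicit.
Unset Printing Implicit Defensive.

Record sgraph (V : finType) := SGraph {
  adj : rel V;
  adj_sym : symmetric adj;
  adj_irr : irreflexive adj
}.

Definition closed_nbh (V : finType) (G : sgraph V) (v : V) : {set V} :=
  [set w | (w == v) || adj G v w].

Definition pair_vertices (V : finType) (S : {set V * V}) : seq V :=
  flatten [seq [:: p.1; p.2] | p <- enum S].

(* Since [S] is a set, [uniq (pair_vertices S)] says that the 2k vertices
   u_1, v_1, ..., u_k, v_k are pairwise distinct; in particular u_i <> v_i. *)
Definition pairing_dominating_set (V : finType) (G : sgraph V)
    (S : {set V * V}) : Prop :=
  uniq (pair_vertices S) /\
  [set: V] = \bigcup_(p in S) (closed_nbh G p.1 :&: closed_nbh G p.2).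

Definition adjacent_pairs (V : finType) (G : sgraph V)
    (S : {set V * V}) : Prop :=
  forall p, p \in S -> adj G p.1 p.2.

Definition isomorphic (V W : finType) (G : sgraph V) (H : sgraph W) : Prop :=
  exists f : V -> W, bijective f /\ forall x y, adj H (f x) (f y) = adj G x y.

Section Induced.
Variables (V : finType) (G : sgraph V) (C : {set V}).

Definition induced_adj : rel {x : V | x \in C} :=
  fun x y => adj G (val x) (val y).

Lemma induced_sym : symmetric induced_adj.
Proof. by move=> x y; apply: adj_sym. Qed.

Lemma induced_irr : irreflexive induced_adj.
Proof. by move=> x; apply: adj_irr. Qed.

Definition induced : sgraph {x : V | x \in C} := SGraph induced_sym induced_irr.

End Induced.

Definition component (V : finType) (G : sgraph V) (x : V) : {set V} :=
  [set y | connect (adj G) x y].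

(* [H] lives on the vertex type of [G], hence is spanning as soon as it is a
   subgraph; every connected component is [component H x] for some [x]. *)
Definition is_factor (I : Type) (W : I -> finType)
    (F : forall i, sgraph (W i)) (V : finType) (G H : sgraph V) : Prop :=
  subrel (adj H) (adj G) /\
  forall x : V, exists i : I, isomorphic (induced H (component H x)) (F i).

Definition has_factor (I : Type) (W : I -> finType)
    (F : forall i, sgraph (W i)) (V : finType) (G : sgraph V) : Prop :=
  exists H : sgraph V, is_factor F G H.

Definition is_left (A B : Type) (x : A + B) : bool :=
  if x is inl _ then true else false.

Section CompleteBipartite.
Variables m n : nat.

Definition biclique_adj : rel ('I_m + 'I_n)%type :=
  fun x y => is_left x != is_left y.

Lemma biclique_sym : symmetric biclique_adj.
Proof. by move=> x y; rewrite /biclique_adj eq_sym. Qed.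

Lemma biclique_irr : irreflexive biclique_adj.
Proof. by move=> x; rewrite /biclique_adj eqxx. Qed.

Definition biclique : sgraph ('I_m + 'I_n)%type :=
  SGraph biclique_sym biclique_irr.

End CompleteBipartite.

Section K2Plus.
Variable l : nat.

Definition K2plus_adj : rel ('I_2 + 'I_l)%type :=
  fun x y => adj (biclique 2 l) x y || [&& is_left x, is_left y & x != y].

Lemma K2plus_sym : symmetric K2plus_adj.
Proof.
by move=> x y; rewrite /K2plus_adj adj_sym eq_sym; case: is_left; case: is_left.
Qed.

Lemma K2plus_irr : irreflexive K2plus_adj.
Proof. by move=> x; rewrite /K2plus_adj adj_irr eqxx !andbF. Qed.

(* For [l = 0] the right part is empty and this is the single edge K_2, as the
   convention for K^+_{2,0} requires. *)
Definition K2plus : sgraph ('I_2 + 'I_l)%type := SGraph K2plus_sym K2plus_irr.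

End K2Plus.

(* Main.v *)
Require Import Defs.
From mathcomp Require Import all_boot.

Set Implicit Arguments.
Unset Strict Implicit.
Unset Printing Implicit Defensive.

(** From a pairing dominating set with adjacent pairs, send each vertex to one
    pair dominating it, a paired vertex going to its own pair. The fibre over
    a pair is then its two vertices (the hubs) together with common neighbours
    of them, and keeping in each fibre only the edges that meet a hub makes it
    a K^+_{2,l}. Conversely, the hubs of the components of a factor form a
    pairing dominating set. *)

(** A sequence, so that [pair_vertices S] unfolds to a concatenation of [hubs]. *)
Definition hubs (V : finType) (p : V * V) : seq V := [:: p.1; p.2].

(** Encodes that [C] induces some K^+_{2,l} whose part of size 2 is [p]. Working in [V] avoids the
    subtype, and being boolean lets [pick] choose such a pair. *)
Definition hub_pair (V : finType) (H : sgraph V) (C : {set V}) (p : V * V) :=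
  [&& p.1 \in C, p.2 \in C, p.1 != p.2 &
      [forall x in C, forall y in C,
        adj H x y == (x != y) && ((x \in hubs p) || (y \in hubs p))]].

Lemma K2plus_adjE l (x y : ('I_2 + 'I_l)%type) :
  adj (K2plus l) x y = (x != y) && (Defs.is_left x || Defs.is_left y).
Proof.
rewrite /= /K2plus_adj /= /biclique_adj.
by case: x => x; case: y => y //=; rewrite ?andbT ?andbF.
Qed.

Lemma isomorphic_sym (V W : finType) (G : sgraph V) (H : sgraph W) :
  isomorphic G H -> isomorphic H G.
Proof.
case=> f [[g fK gK] fE]; exists g; split; first by exists f.
by move=> x y; rewrite -fE !gK.
Qed.

Lemma hubs_isomorphic (W : finType) (H : sgraph W) (p : W * W) :
    p.1 != p.2 ->
    (forall x y,
      adj H x y = (x != y) && ((x \in hubs p) || (y \in hubs p))) ->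
  exists l, isomorphic H (K2plus l).
Proof.
move=> neq_p adjE; pose L := [set x | x \notin hubs p].
pose g (z : ('I_2 + 'I_#|L|)%type) : W :=
  match z with
  | inl i => if i == ord0 then p.1 else p.2
  | inr j => enum_val j
  end.
have g_hub z : (g z \in hubs p) = Defs.is_left z.
  case: z => [i|j] /=; first by case: ifP; rewrite !inE eqxx ?orbT.
  by have := enum_valP j; rewrite inE => /negbTE.
have g_inj : injective g.
  move=> z t eq_g; have := g_hub z; rewrite eq_g g_hub.
  case: z t eq_g => [i|j] [i'|j'] //= eq_g _; last by rewrite (enum_val_inj eq_g).
  congr inl; apply: val_inj; move: eq_g neq_p.
  by case: i i' => [[|[|i]] ?] [[|[|i']] ?] //= ->; rewrite eqxx.
(* The complement of [L] consists of the hubs, hence has at most two elements. With this bound the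
   injectivity of [g] already gives bijectivity, and no inverse has to be built. *)
have cardW : #|W| <= #|{: 'I_2 + 'I_#|L|}|.
  rewrite card_sum !card_ord -(cardsC L) addnC leq_add2r.
  apply: leq_trans (card_size (hubs p)); apply/subset_leq_card/subsetP => x.
  by rewrite !inE negbK.
exists #|L|; apply: isomorphic_sym; exists g; split; first exact: inj_card_bij.
by move=> x y; rewrite K2plus_adjE adjE (inj_eq g_inj) !g_hub.
Qed.

Lemma isomorphic_hubs {W : finType} {H : sgraph W} {l : nat} :
    isomorphic H (K2plus l) ->
  exists2 p : W * W, p.1 != p.2 &
    forall x y, adj H x y = (x != y) && ((x \in hubs p) || (y \in hubs p)).
Proof.
case=> f [[g fK gK] fE].
(* The hubs are the preimages of the two vertices of the part of size 2. *)
exists (g (inl ord0), g (inl ord_max)) => [|x y].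
  by rewrite /= (inj_eq (can_inj gK)).
have left_f z : (z \in hubs (g (inl ord0), g (inl ord_max))) = Defs.is_left (f z).
  rewrite -{1}[z]fK !inE !(inj_eq (can_inj gK)).
  by case: (f z) => [[[|[|i]] ?]|j].
by rewrite -fE K2plus_adjE (inj_eq (can_inj fK)) !left_f.
Qed.

Lemma hub_pairP (V : finType) (H : sgraph V) (C : {set V}) :
  (exists p, hub_pair H C p) <->
  (exists l, isomorphic (induced H C) (K2plus l)).
Proof.
split=> [[[a b] /and4P[/= aC bC neq_ab /forall_inP adjE]]|[l iso]].
  apply: (@hubs_isomorphic _ _ (Sub a aC, Sub b bC)) => // x y.
  by have /forall_inP/(_ _ (valP y))/eqP := adjE _ (valP x); rewrite !inE.
have [[a b] neq_ab adjE] := isomorphic_hubs iso.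
exists (val a, val b); rewrite /hub_pair /= (valP a) (valP b) (inj_eq val_inj) neq_ab /=.
apply/forall_inP => x xC; apply/forall_inP => y yC.
by have /= := adjE (Sub x xC) (Sub y yC); rewrite /induced_adj /= !inE => ->.
Qed.

(** Stated for a sequence to allow induction: the hubs of the head must differ from each other and
    avoid those of the tail. *)
Lemma uniq_flatten_hubs (V : finType) (s : seq (V * V)) :
    uniq s ->
  uniq (flatten [seq hubs p | p <- s]) <->
  {in s, forall p, p.1 != p.2} /\
  {in s &, forall p q x, x \in hubs p -> x \in hubs q -> p = q}.
Proof.
elim: s => [//|p s IHs] /andP[ps /IHs{}IHs].
have -> : flatten [seq hubs q | q <- p :: s] =
    hubs p ++ flatten [seq hubs q | q <- s] by [].
rewrite cat_uniq; split.
  case/and3P=> p12 /hasPn disj /IHs[neq_s inj_s].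
  have disjP q x : q \in s -> x \in hubs q -> x \notin hubs p.
    by move=> qs xq; apply: disj; apply/flatten_mapP; exists q.
  split=> [q|q r].
    by case/predU1P=> [->|/neq_s //]; move: p12; rewrite /= inE andbT.
  case/predU1P=> [->|qs] /predU1P[->|rs] x xq xr //.
  - by have := disjP _ _ rs xr; rewrite xq.
  - by have := disjP _ _ qs xq; rewrite xr.
  - exact: inj_s xq xr.
case=> neq_s inj_s; have sub_s := @mem_behead _ (p :: s).
apply/and3P; split.
- by rewrite /= inE andbT neq_s ?mem_head.
- apply/hasPn => x /flatten_mapP[q qs xq]; apply/negP => xp.
  have eq_pq := inj_s p q (mem_head _ _) (sub_s q qs) x xp xq.
  by rewrite eq_pq qs in ps.
- apply/IHs; split=> [q qs|q r qs rs]; first by apply/neq_s/sub_s.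
  by apply: inj_s; apply: sub_s.
Qed.

Lemma uniq_pair_vertices (V : finType) (S : {set V * V}) :
  uniq (pair_vertices S) <->
  {in S, forall p, p.1 != p.2} /\
  {in S &, forall p q x, x \in hubs p -> x \in hubs q -> p = q}.
Proof.
apply: iff_trans (uniq_flatten_hubs (enum_uniq (mem S))) _; split=> -[neqS injS].
  by split=> [p pS|p q pS qS]; [apply: neqS|apply: injS]; rewrite mem_enum.
by split=> [p|p q]; rewrite !mem_enum; [apply: neqS|apply: injS].
Qed.

Section FibreGraph.
Variables (V : finType) (c : V -> V * V).

Definition fibre_adj : rel V := fun x y =>
  [&& c x == c y, x != y & (x \in hubs (c x)) || (y \in hubs (c x))].

Lemma fibre_sym : symmetric fibre_adj.
Proof.
move=> x y; rewrite /fibre_adj eq_sym [x == y]eq_sym.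
by case: eqP => //= ->; rewrite orbC.
Qed.

Lemma fibre_irr : irreflexive fibre_adj.
Proof. by move=> x; rewrite /fibre_adj !eqxx. Qed.

Definition fibre_graph : sgraph V := SGraph fibre_sym fibre_irr.

(** Each fibre thus contains both hubs of its pair, which is what makes it connected. *)
Hypothesis hub_fibre : forall x y, y \in hubs (c x) -> c y = c x.

(** Edges preserve [c], so a component stays inside a fibre; conversely, any two vertices of a fibre
    are joined through its first hub. *)
Lemma component_fibre x : component fibre_graph x = [set y | c y == c x].
Proof.
apply/setP=> y; rewrite !inE; apply/idP/eqP => [|cyx].
  case/connectP=> s + ->; elim: s x => //= z s IHs x /andP[/and3P[/eqP-> _ _]].
  exact: IHs.
have conn_hub z : connect fibre_adj z (c z).1.
  have [<-|neq_z] := eqVneq z (c z).1; first exact: connect0.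
  apply: connect1; rewrite /fibre_adj neq_z [(c z).1 \in _]mem_head orbT !andbT.
  by rewrite (@hub_fibre z) ?mem_head.
apply: connect_trans (conn_hub x) _.
by rewrite (sym_connect_sym fibre_sym) -cyx conn_hub.
Qed.

End FibreGraph.

Lemma fibre_factor (V : finType) (G : sgraph V) (S : {set V * V}) :
    pairing_dominating_set G S -> adjacent_pairs G S ->
  has_factor K2plus G.
Proof.
case=> /uniq_pair_vertices[neqS injS] domS adjS.
(* The last clause forces a paired vertex to choose its own pair, which dominates it because the
   pair is adjacent. For an unpaired vertex that clause is vacuous, and any dominating pair will
   do. *)
have own_pair v : exists p, [/\ p \in S,
    v \in closed_nbh G p.1 :&: closed_nbh G p.2
    & forall q, q \in S -> v \in hubs q -> p = q].
  have [q /andP[qS vq]|no_pair] := pickP [pred q in S | v \in hubs q].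
    exists q; split=> // [|r rS vr]; last exact: injS vq vr.
    rewrite !inE; move: vq (adjS q qS); rewrite !inE.
    by case/orP=> /eqP->; rewrite eqxx ?orbT //= adj_sym => ->; rewrite orbT.
  have: v \in [set: V] by [].
  rewrite domS => /bigcupP[p pS vp]; exists p; split=> // q qS vq.
  by have := no_pair q; rewrite /= qS vq.
have [c cP] := fin_all_exists own_pair.
have cS x : c x \in S by case: (cP x).
have hub_fibre x y : y \in hubs (c x) -> c y = c x.
  by case: (cP y) => _ _; apply.
(* The pair of [y] dominates [y] through both of its members, and [x] is one of them, distinct from
   [y]. *)
have hubG x y : c x = c y -> x != y -> x \in hubs (c x) -> adj G x y.
  move=> cxy neq_xy; rewrite cxy; have [_ + _] := cP y.
  rewrite !inE => /andP[y1 y2] /orP[] /eqP eq_x; rewrite -eq_x in y1 y2.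
    by move: y1; rewrite eq_sym (negbTE neq_xy).
  by move: y2; rewrite eq_sym (negbTE neq_xy).
exists (fibre_graph c); split=> [x y /and3P[/eqP cxy neq_xy] /orP[]|x].
- exact: hubG.
- by rewrite cxy adj_sym => yc; apply: hubG; rewrite // eq_sym.
apply/hub_pairP; exists (c x); rewrite component_fibre // /hub_pair !inE.
rewrite (hub_fibre x (c x).1) ?(hub_fibre x (c x).2) ?inE ?eqxx ?orbT ?neqS //=.
apply/forall_inP => y; rewrite inE => /eqP cy.
apply/forall_inP => z; rewrite inE => /eqP cz.
by rewrite /fibre_adj cy cz eqxx.
Qed.

Lemma factor_pairing (V : finType) (G : sgraph V) :
    has_factor K2plus G ->
  exists S, pairing_dominating_set G S /\ adjacent_pairs G S.
Proof.
case=> H [subHG compH].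
(* The default [(x, x)] is never reached, since each component has a hub pair. *)
pose h x := odflt (x, x) [pick p | hub_pair H (component H x) p].
have hP x : hub_pair H (component H x) (h x).
  rewrite /h; case: pickP => //= none.
  by have [p] := (hub_pairP H (component H x)).2 (compH x); rewrite none.
have neq_h x : (h x).1 != (h x).2 by case/and4P: (hP x).
have h_comp x y : y \in hubs (h x) -> y \in component H x.
  by rewrite !inE; case/and4P: (hP x) => + + _ _; rewrite !inE => ? ? /orP[]/eqP->.
(* [pick] depends only on the component; the default would depend on the vertex, so it must be ruled
   out again here. *)
have component_eq x y z : z \in component H x -> z \in component H y ->
    h x = h y.
  have connC := sym_connect_sym (@adj_sym _ H).
  rewrite !inE => xz yz.
  have eqC : component H x = component H y.
    apply/setP=> t; rewrite !inE (same_connect connC xz).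
    by rewrite (same_connect connC yz).
  rewrite /h eqC; case: pickP => //= none.
  by have := hP y; rewrite none.
have adj_hub x y z : y \in component H x -> z \in hubs (h x) -> y != z ->
    adj H z y.
  move=> yC zh neq_yz; case/and4P: (hP x) => _ _ _ /forall_inP/(_ z (h_comp _ _ zh)).
  by move=> /forall_inP/(_ y yC)/eqP->; rewrite zh eq_sym neq_yz.
(* Since [h] is constant on components, this set holds one pair per component. *)
exists [set h x | x : V]; split; last first.
  move=> _ /imsetP[x _ ->]; apply/subHG/(adj_hub x) => //.
  - by apply: h_comp; rewrite !inE eqxx orbT.
  - exact: mem_head.
  - by rewrite eq_sym.
split.
  apply/uniq_pair_vertices; split=> [_ /imsetP[x _ ->] //|].
  move=> _ _ /imsetP[x _ ->] /imsetP[y _ ->] z /h_comp zx /h_comp zy.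
  exact: component_eq zx zy.
apply/esym/setP => x; rewrite [RHS]inE; apply/bigcupP.
exists (h x); first exact: imset_f.
have near_hub z : z \in hubs (h x) -> x \in closed_nbh G z.
  move=> zh; rewrite inE; case: eqVneq => //= neq_xz.
  by apply/subHG/(adj_hub x); rewrite // inE connect0.
by rewrite inE !near_hub // !inE eqxx ?orbT.
Qed.

Theorem proposition4p1 (V : finType) (G : sgraph V) :
  (exists S : {set V * V}, pairing_dominating_set G S /\ adjacent_pairs G S)
  <-> has_factor K2plus G.
Proof.
by split=> [[S [domS adjS]]|]; [apply: fibre_factor adjS|apply: factor_pairing].
Qed.
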